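(* Let $K$ be a non-metrisable, compact Hausdorff space. Then the unit sphere of $C(K)$ contains an uncountable $(1+)$-separated subset. Furthermore: (i) if $K$ is not perfectly normal, then the unit sphere of $C(K)$ contains an uncountable $2$-equilateral set; (ii) if $K$ is perfectly normal, then the unit sphere of $C(K)$ contains a $(1+)$-separated subset of cardinality equal to the density of $C(K)$.
   Context: $C(K)$ is the Banach space of real-valued continuous functions on $K$ with the supremum norm. A subset $A$ of a Banach space is $(1+)$-separated if $\|x-y\|>1$ for all distinct $x,y\in A$; it is $2$-equilateral if $\|x-y\|=2$ for all distinct $x,y\in A$. A compact Hausdorff space $K$ is perfectly normal if each closed subset of $K$ is a $G_\delta$ set. The density of a Banach space is the minimal cardinality of a dense subset. *)

(* Defs.v *)
From HB Require Import structures.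
From mathcomp Require Import all_boot all_order all_algebra.
From mathcomp Require Import all_classical all_reals all_analysis borel_hierarchy.
From mathcomp Require Import ring.
Set Implicit Arguments.
Unset Strict Implicit.
Unset Printing Implicit Defensive.
Import Order.TTheory GRing.Theory Num.Theory.
Import numFieldNormedType.Exports.
Local Open Scope classical_set_scope.
Local Open Scope ring_scope.

Definition metrisable (R : realType) (T : topologicalType) : Prop :=
  exists d : T -> T -> R,
    [/\ forall x y, d x y = 0 <-> x = y,
        forall x y, d x y = d y x,
        forall x y z, d x z <= d x y + d y z &
        forall x, nbhs x =
          filter_from [set e | 0 < e] (fun e => [set y | d x y < e])].

(* For compact Hausdorff spaces, where normality is automatic. *)
Definition perfectly_normal (T : topologicalType) : Prop :=
  forall F : set T, closed F -> Gdelta F.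

Section continuous_functions_predicate.
Context {R : realType} {K : topologicalType}.

Definition cfun : {pred K -> R} := mem [set f : K -> R | continuous f].
Definition cfun_key : pred_key cfun. Proof. exact. Qed.
Canonical cfun_keyed := KeyedPred cfun_key.

Lemma cfun_submod_closed : submod_closed cfun.
Proof.
split; first by rewrite inE => x; exact: cvg_cst.
move=> a f g /[!inE]/= cf cg x.
by apply: cvgD; [apply: cvgZr; exact: cf|exact: cg].
Qed.

HB.instance Definition _ :=
  GRing.isSubmodClosed.Build R (K -> R) cfun cfun_submod_closed.

End continuous_functions_predicate.

(* The compactness proof is a parameter of the type because the supremum norm
   is a norm only when all the functions are bounded. *)
Record C (R : realType) (K : topologicalType) (cK : compact [set: K]) :=
  MkC { C_fun :> K -> R ; C_funP : C_fun \in cfun }.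
Arguments C R {K} cK.

Section C_normedModType.
Context {R : realType} {K : topologicalType} {cK : compact [set: K]}.
Local Notation CK := (C R cK).

HB.instance Definition _ := [isSub for @C_fun R K cK].
HB.instance Definition _ := [Choice of CK by <:].
HB.instance Definition _ := [SubChoice_isSubLmodule of CK by <:].

Definition supnorm (f : CK) : R := sup [set `|f x| | x in [set: K]].

Lemma C_bounded (f : CK) : has_ubound [set `|f x| | x in [set: K]].
Proof.
have cf : continuous (f : K -> R) by have := C_funP f; rewrite inE.
have : compact [set f x | x in [set: K]].
  by apply: continuous_compact => //; exact: continuous_subspaceT.
move=> /compact_bounded[M [_ Mf]]; exists (M + 1) => _ [x _ <-].
by apply: Mf; [rewrite ltrDl|exists x].
Qed.

Lemma supnorm_ge (f : CK) x : `|f x| <= supnorm f.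
Proof. by apply: ub_le_sup; [exact: C_bounded|exists x]. Qed.

Lemma supnorm_le (f : CK) e : 0 <= e -> (forall x, `|f x| <= e) ->
  supnorm f <= e.
Proof.
move=> e0 fe; have [/set0P fn0|/negPn/eqP f0] :=
  boolP ([set `|f x| | x in [set: K]] != set0).
  by apply: ge_sup => // _ [x _ <-].
by rewrite /supnorm f0 sup0.
Qed.

Lemma supnorm_ge0 (f : CK) : 0 <= supnorm f.
Proof.
have [[_ [x _ _]]|/nonemptyPn f0] :=
  pselect ([set `|f x| | x in [set: K]] !=set0).
  exact: le_trans (supnorm_ge f x).
by rewrite /supnorm f0 sup0.
Qed.

Lemma supnormD (f g : CK) : supnorm (f + g) <= supnorm f + supnorm g.
Proof.
apply: supnorm_le => [|x]; first by rewrite addr_ge0// supnorm_ge0.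
by rewrite (le_trans (ler_normD _ _))// lerD// supnorm_ge.
Qed.

Lemma supnormZ (a : R) (f : CK) : supnorm (a *: f) = `|a| * supnorm f.
Proof.
have le_supnormZ b (g : CK) : supnorm (b *: g) <= `|b| * supnorm g.
  apply: supnorm_le => [|x]; first by rewrite mulr_ge0// supnorm_ge0.
  by rewrite normrM ler_wpM2l// supnorm_ge.
apply/eqP; rewrite eq_le le_supnormZ/=.
have [->|a0] := eqVneq a 0; first by rewrite normr0 mul0r supnorm_ge0.
by rewrite -ler_pdivlMl ?normr_gt0// -normfV -{1}[f](scalerK a0) le_supnormZ.
Qed.

Lemma supnorm_eq0 (f : CK) : supnorm f = 0 -> f = 0.
Proof.
move=> f0; apply/val_inj/funext => x /=.
by apply/eqP; rewrite -normr_le0 -f0 supnorm_ge.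
Qed.

HB.instance Definition _ :=
  Lmodule_isNormed.Build R CK supnormD supnormZ supnorm_eq0.

Lemma C_cauchy_cvg (F : set_system CK) : ProperFilter F -> cauchy F -> cvg F.
Proof.
move=> PF /cauchyP Fc.
pose ev (x : K) (f : CK) : R^o := f x.
have Fev x : cvg (ev x @ F).
  apply: cauchy_cvg; apply/cauchyP => e e0; have [f Ff] := Fc e e0.
  exists (f x); apply: (@filterS _ F _ (ball f e)) Ff => g.
  rewrite -!ball_normE/= => fg.
  by apply: le_lt_trans fg; exact: (supnorm_ge (f - g) x).
pose l (x : K) : R := lim (ev x @ F).
have Fl (e : R) : 0 < e -> \forall f \near F, forall x : K, `|l x - (f : CK) x| <= e.
  move=> e0; have [f Ff] := Fc _ (divr_gt0 e0 (ltr0Sn R 1)).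
  have near_f (g : CK) : ball f (e / 2) g -> forall x, `|f x - g x| <= e / 2.
    rewrite -ball_normE/= => /ltW fg x.
    exact: le_trans (supnorm_ge (f - g) x) fg.
  have gh_le (g h : CK) : ball f (e / 2) g -> ball f (e / 2) h ->
      forall x, `|ev x h - g x| <= e.
    move=> /near_f fg /near_f fh x; rewrite [leRHS]splitr.
    by rewrite (le_trans (ler_distD (f x) _ _))// lerD// distrC.
  apply: filterS (Ff) => g fg x; rewrite ler_distl; apply/andP; split.
    apply: limr_ge; first exact: Fev.
    by apply: filterS Ff => h /(gh_le _ _ fg)/(_ x); rewrite ler_distl => /andP[].
  apply: limr_le; first exact: Fev.
  by apply: filterS Ff => h /(gh_le _ _ fg)/(_ x); rewrite ler_distl => /andP[].
have cl : l \in cfun.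
  rewrite inE/= => x; apply/cvgrPdist_le => e e0.
  have e30 : 0 < e / 3 by rewrite divr_gt0.
  have [g lg] := @filter_ex _ _ PF _ (Fl _ e30).
  have cg : continuous (g : K -> R) by have := C_funP g; rewrite inE.
  have /cvgrPdist_le/(_ _ e30) := cg x.
  apply: filterS => y gxy.
  have -> : e = e / 3 + (e / 3 + e / 3) by field.
  rewrite (le_trans (ler_distD (g x) _ _))// lerD//.
  by rewrite (le_trans (ler_distD (g y) _ _))// lerD// distrC.
apply/cvg_ex; exists (MkC cK cl); apply/cvgrPdist_le => e e0.
by apply: filterS (Fl _ e0) => f lf; apply: supnorm_le => //; exact: ltW.
Qed.

HB.instance Definition _ := Uniform_isComplete.Build CK C_cauchy_cvg.

End C_normedModType.

Section normed_spaces.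
Context {R : realType} {V : normedModType R}.
Implicit Types A : set V.

Definition unit_sphere : set V := [set x | `|x| = 1].

Definition one_plus_separated A : Prop :=
  forall x y, A x -> A y -> x <> y -> 1 < `|x - y|.

Definition equilateral (lambda : R) A : Prop :=
  forall x y, A x -> A y -> x <> y -> `|x - y| = lambda.

End normed_spaces.
Arguments unit_sphere {R} V.

(* Cardinals are not objects: the density character of [V] enters as the
   property, of a set [A], of having the least cardinality of a dense subset
   of [V]. *)
Definition has_density_card (V : topologicalType) (T : Type) (A : set T) : Prop :=
  (exists2 D : set V, dense D & (A #= D)%card) /\
  (forall D : set V, dense D -> (A #<= D)%card).

(* Main.v *)
Require Import Defs.
From mathcomp Require Import all_boot all_order all_algebra.
From mathcomp Require Import all_classical all_reals all_analysis.
From mathcomp Require Import borel_hierarchy lra ring.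
Set Implicit Arguments.
Unset Strict Implicit.
Unset Printing Implicit Defensive.
Import Order.TTheory GRing.Theory Num.Theory.
Import numFieldNormedType.Exports.
Local Open Scope classical_set_scope.
Local Open Scope ring_scope.

(* Both families are maximal ones given by Zorn's lemma.

   If the closed set F is not a G_delta, take a maximal 2-equilateral family of
   functions K -> [-1, 1] equal to 1 on F and taking the value -1.  Were it
   countable, its members would all equal 1 at some point x outside F, and a
   function equal to 1 on F and to -1 at x would enlarge it.

   If K is perfectly normal, take a maximal (1+)-separated family A of norm-one
   functions all of whose zeros are limits of points where the function is
   negative.  Then A separates points: suppose that all its members agree at
   x <> y, let V be an open neighbourhood of y with x outside cl V, and let f be
   1 near x, -1 at y, negative exactly on V and zero elsewhere on cl V.  For g in
   A with g(x) = g(y) = c, the distance of f and g exceeds 1, as seen at y if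
   c > 0, at x if c < 0, and at a point near x where g < 0 if c = 0.  So f could
   be added.  As K is not metrisable, A is uncountable, and the lattice generated
   by the rational affine images of its members is dense (Stone-Weierstrass) and
   of the same cardinality as A.  Conversely a dense set meets the disjoint balls
   of radius 1/2 around the points of A. *)

(** * Comparability of cardinals and squares of infinite sets *)

(** Zorn's lemma for graphs of partial injections from [A] to [B]: a maximal one is total on [A] or
    onto [B], since otherwise a pair of missed points could be added. *)
Lemma card_le_total (T U : pointedType) (A : set T) (B : set U) :
  (A #<= B)%card \/ (B #<= A)%card.
Proof.
pose P (G : set (T * U)) :=
  G `<=` A `*` B /\
  forall s t, G s -> G t -> (s.1 = t.1 <-> s.2 = t.2).
have [G [[GAB Ginj] Gmax]] : exists G, P G /\ forall H, G `<` H -> ~ P H.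
  apply: Zorn_bigcup => F FP Ftot; split; first by apply: bigcup_sub => X /FP[].
  move=> s t [X FX Xs] [Y FY Yt]; have [XY|YX] := Ftot _ _ FX FY.
    by have [_] := FP _ FY; apply => //; exact: XY.
  by have [_] := FP _ FX; apply => //; exact: YX.
have [domG|] := pselect (forall a, A a -> exists b, G (a, b)).
  left; have /choice[f Gf] a : exists b, A a -> G (a, b).
    by have [/domG[b]|] := pselect (A a); [exists b|exists point].
  apply/pcard_leP/injfunPex; exists f => [a /Gf/GAB[]//|a b].
  by move=> /set_mem/Gf Ga /set_mem/Gf Gb fab; exact: (Ginj _ _ Ga Gb).2.
move=> /existsNP[a /not_implyP[Aa /forallNP Ga]]; right.
have ranG b : B b -> exists a, G (a, b).
  move=> Bb; apply: contrapT => /forallNP Gb.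
  apply: (Gmax (G `|` [set (a, b)])).
    split; first exact: subsetUl.
    by move=> /(_ (a, b)) GH; apply: (Ga b); apply: GH; right.
  split; first by move=> s [/GAB//|->].
  have bad s : G s -> s.1 <> a /\ s.2 <> b.
    case: s => s1 s2 Gs; split=> /= E; first by apply: (Ga s2); rewrite -E.
    by apply: (Gb s1); rewrite -E.
  move=> s t [Gs|->] [Gt|->] //; first exact: Ginj.
    by have [] := bad _ Gs; split.
  by have [na nb] := bad _ Gt; split=> /esym.
have /choice[f Gf] b : exists a, B b -> G (a, b).
  by have [/ranG[c]|] := pselect (B b); [exists c|exists point].
apply/pcard_leP/injfunPex; exists f => [b /Gf/GAB[]//|b c].
by move=> /set_mem/Gf Gb /set_mem/Gf Gc fbc; exact: (Ginj _ _ Gb Gc).1.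
Qed.

Section infinite_square.
Context {T : pointedType}.
Implicit Types (G : set (T * T * T)) (A : set T).

(* The graph of an injection [B `*` B -> B]; [B] is recovered from the
   diagonal. *)
Definition square_dom G : set T := [set a | exists c, G (a, a, c)].

Definition square_graph A G :=
  [/\ forall s t, G s -> G t -> (s.1 = t.1 <-> s.2 = t.2),
      forall a b, square_dom G a -> square_dom G b -> exists c, G (a, b, c),
      forall a b c, G (a, b, c) ->
        [/\ square_dom G a, square_dom G b & square_dom G c] &
      square_dom G `<=` A].

(** Each clause of [square_graph] starts from at most two triples of [G], so it can be checked in a
    subgraph containing both. This serves for unions of chains. *)
Lemma square_graph_directed A G :
  (forall s t, G s -> G t ->
    exists H, [/\ square_graph A H, H `<=` G, H s & H t]) ->
  square_graph A G.
Proof.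
move=> dirG; have domS H : H `<=` G -> square_dom H `<=` square_dom G.
  by move=> HG a [c Hc]; exists c; exact: HG.
split.
- by move=> s t Gs Gt; have [H [[+ _ _ _] _ Hs Ht]] := dirG _ _ Gs Gt; exact.
- move=> a b [c Gc] [d Gd]; have [H [[_ + _ _] HG Hc Hd]] := dirG _ _ Gc Gd.
  by move=> /(_ a b)[||e He]; [exists c|exists d|exists e; exact: HG].
- move=> a b c Gc; have [H [[_ _ + _] HG Hc _]] := dirG _ _ Gc Gc.
  by move=> /(_ _ _ _ Hc)[? ? ?]; split; exact: (domS _ HG).
- move=> a [c Gc]; have [H [[_ _ _ +] _ Hc _]] := dirG _ _ Gc Gc.
  by apply; exists c.
Qed.

Lemma square_graph_max A : infinite_set A ->
  exists (e : nat -> T) G, [/\ injective e, square_graph A G,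
    forall n, square_dom G (e n) &
    forall H, square_graph A H -> G `<=` H -> H `<=` G].
Proof.
move=> /infiniteP/pcard_leP/injfunPex[e eA /in2TT einj].
have {}einj : injective e by move=> m n; apply: einj; rewrite inE.
(* The pairing [pickle] on [nat], transported along [e]; starting from it keeps the domain
   infinite. *)
pose G0 : set (T * T * T) :=
  [set ((e mn.1, e mn.2), e (pickle mn)) | mn in [set: nat * nat]].
have G0dom : square_dom G0 = range e.
  apply/seteqP; split=> [a [c [[m n] _ [<- _ _]]]|_ [n _ <-]].
    by exists m.
  by exists (e (pickle (n, n))); exists (n, n).
have G0sq : square_graph A G0.
  split; rewrite ?G0dom.
  - move=> _ _ [[m n] _ <-] [[m' n'] _ <-] /=; split.
      by move=> [/einj-> /einj->].
    by move=> /einj/(pcan_inj pickleK)[-> ->].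
  - by move=> _ _ [m _ <-] [n _ <-]; exists (e (pickle (m, n))), (m, n).
  - by move=> _ _ _ [[m n] _ [<- <- <-]]; split; exact: imageP.
  - by move=> _ [n _ <-]; exact: eA.
(* Zorn's lemma is applied to the part added to [G0], because the union of the empty chain must
   qualify too. *)
have [X [PX Xmax]] : exists X, square_graph A (G0 `|` X) /\
    forall Y, X `<` Y -> ~ square_graph A (G0 `|` Y).
  apply: (@Zorn_bigcup _ [set X | square_graph A (G0 `|` X)]) => F FP Ftot.
  have sub X : F X -> G0 `|` X `<=` G0 `|` \bigcup_(X in F) X.
    by move=> FX; apply: setUS; exact: bigcup_sup.
  apply: square_graph_directed => s t [Gs|[X FX Xs]] [Gt|[Y FY Yt]].
  - by exists G0; split=> //; exact: subsetUl.
  - exists (G0 `|` Y); split; [exact: FP|exact: sub|by left|by right].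
  - exists (G0 `|` X); split; [exact: FP|exact: sub|by right|by left].
  - have [XY|YX] := Ftot _ _ FX FY.
    + exists (G0 `|` Y); split; [exact: FP|exact: sub| |by right].
      by right; exact: XY.
    + exists (G0 `|` X); split; [exact: FP|exact: sub|by right|].
      by right; exact: YX.
exists e, (G0 `|` X); split=> // [n|H HA GH].
  exists (e (pickle (n, n))); left; by exists (n, n).
have [HX|HX] := pselect (H `<=` X).
  by apply: subset_trans HX _; exact: subsetUr.
exfalso; apply: (Xmax H); first by split=> // x Xx; apply: GH; right.
by rewrite (_ : _ `|` _ = H)//; apply/setUidPr => x Gx; apply: GH; left.
Qed.

(* Extending a maximal injection [B `*` B -> B] by new pairs shows that [B] does
   not inject into [A `\` B]; by comparability, [A] then injects into two copies
   of [B], hence into [B `*` B]. *)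
Lemma infinite_card_setX A : infinite_set A -> (A `*` A #<= A)%card.
Proof.
move=> /square_graph_max[e [G [einj Gsq Ge Gmax]]].
have [Ginj Gdom Gran GA] := Gsq; pose B := square_dom G.
have /choice[f Gf] (ab : T * T) : exists c, B ab.1 -> B ab.2 -> G (ab, c).
  have [[Ba Bb]|nB] := pselect (B ab.1 /\ B ab.2).
    by have [c Gc] := Gdom _ _ Ba Bb; exists c; rewrite [ab]surjective_pairing.
  by exists point => Ba Bb; exfalso; exact: nB.
have {}Gf a b : B a -> B b -> G (a, b, f (a, b)) by move=> *; exact: Gf.
have fB a b : B a -> B b -> B (f (a, b)).
  by move=> Ba Bb; have [] := Gran _ _ _ (Gf _ _ Ba Bb).
have finj a b a' b' : B a -> B b -> B a' -> B b' ->
    f (a, b) = f (a', b') -> a = a' /\ b = b'.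
  move=> Ba Bb Ba' Bb' /(Ginj _ _ (Gf _ _ Ba Bb) (Gf _ _ Ba' Bb')).
  by case.
pose tag (s : bool) := e s.
have Btag s : B (tag s) by exact: Ge.
have taginj s s' : tag s = tag s' -> s = s' by move=> /einj; case: s; case: s'.
have [AB|BA] := card_le_total (A `\` B) B.
  have /pcard_leP/injfunPex[h hB hinj] := AB.
  (* [k] injects [A] into [B]: the tags keep the images of [B] and of its complement apart. *)
  pose k a := if a \in B then f (tag false, a) else f (tag true, h a).
  have {}hB c : A c -> ~ c \in B -> B (h c).
    by move=> Ac nc; apply: hB; split=> // /mem_set.
  have {}hinj a b : A a -> ~ a \in B -> A b -> ~ b \in B -> h a = h b -> a = b.
    by move=> Aa nBa Ab nBb; apply: hinj; apply/mem_set; split=> // /mem_set.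
  have kB a : A a -> B (k a).
    rewrite /k; have [/set_mem Ba _|/negP nBa Aa] := boolP (a \in B).
      exact: fB.
    by apply: fB => //; exact: hB.
  have kinj a b : A a -> A b -> k a = k b -> a = b.
    rewrite /k; have [/set_mem Ba|/negP nBa] := boolP (a \in B);
      have [/set_mem Bb|/negP nBb] := boolP (b \in B) => Aa Ab.
    - by move=> /finj[].
    - by move=> /finj[]; auto => /taginj.
    - by move=> /finj[]; auto => /taginj.
    - by move=> /finj[]; auto.
  apply/pcard_leP/injfunPex; exists (fun ab => f (k ab.1, k ab.2)).
    by move=> [a b] [/= Aa Ab]; apply: GA; exact: fB (kB _ _) (kB _ _).
  move=> [a b] [a' b'] /set_mem[/= Aa Ab] /set_mem[/= Aa' Ab'].
  by move=> /finj[]; rewrite -/B; auto => /kinj-> // /kinj->.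
have /pcard_leP/injfunPex[i iA iinj] := BA.
have {}iinj a b : B a -> B b -> i a = i b -> a = b.
  by move=> Ba Bb; apply: iinj; exact/mem_set.
have iB b : B b -> ~ B (i b) by move=> /iA[].
pose r (s : bool) b := if s then i b else b.
have rinj s b s' b' : B b -> B b' -> r s b = r s' b' -> s = s' /\ b = b'.
  move=> Bb Bb'; case: s; case: s' => //= E.
  - by split=> //; exact: iinj E.
  - by have := iB _ Bb; rewrite E.
  - by have := iB _ Bb'; rewrite -E.
pose code s b s' b' := f (f (tag s, tag s'), f (b, b')).
have codeB s b s' b' : B b -> B b' -> B (code s b s' b').
  by move=> Bb Bb'; apply: (fB) (fB _ _ _ _) (fB _ _ _ _).
have codeinj s1 b1 s1' b1' s2 b2 s2' b2' : B b1 -> B b1' -> B b2 -> B b2' ->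
    code s1 b1 s1' b1' = code s2 b2 s2' b2' ->
    [/\ s1 = s2, s1' = s2', b1 = b2 & b1' = b2'].
  move=> ? ? ? ? /finj[]; [exact: fB..|].
  by move=> /finj[]// /taginj-> /taginj-> /finj[]// -> ->.
(* The new pairs are those over [B] and its copy under [i] with at least one coordinate in the copy.
   Their values lie in the copy, so they cannot clash with those of [G]. *)
pose N : set (T * T * T) := [set t | exists s b s' b',
  [/\ B b, B b', s || s' & t = (r s b, r s' b', i (code s b s' b'))]].
have domGN : square_dom (G `|` N) = [set a | exists s b, B b /\ a = r s b].
  apply/seteqP; split=> [a [c [Gc|]]|_ [[] [b [Bb ->]]]].
  - by exists false, a; split=> //; exists c.
  - by move=> [s [b [s' [b' [Bb _ _ [-> _ _]]]]]]; exists s, b.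
  - by exists (i (code true b true b)); right; exists true, b, true, b.
  - by have [c Gc] := Bb; exists c; left.
have GNsq : square_graph A (G `|` N).
  have mix s t : G s -> N t -> s.1 <> t.1 /\ s.2 <> t.2.
    move=> + [u [b [u' [b' [Bb Bb' uu' ->]]]]]; case: s => -[a a'] c /= Gs.
    have [Ba Ba' Bc] := Gran _ _ _ Gs; split.
      case=> aE a'E; move: uu' aE a'E; case: u => [_ aE _|/= -> _ a'E].
        by apply: (iB _ Bb); rewrite -[i b]aE.
      by apply: (iB _ Bb'); rewrite -[i b']a'E.
    by move=> cE; apply: (iB (code u b u' b')); [exact: codeB|rewrite -cE].
  split; rewrite ?domGN.
  - move=> s t [Gs|Ns] [Gt|Nt]; first exact: Ginj.
    + by have [] := mix _ _ Gs Nt; split.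
    + by have [n1 n2] := mix _ _ Gt Ns; split=> /esym.
    move: Ns Nt => [u [b [u' [b' [Bb Bb' _ ->]]]]].
    move=> [v [c [v' [c' [Bc Bc' _ ->]]]]] /=; split.
      by case=> /rinj[]// -> -> /rinj[]// -> ->.
    move=> /iinj E; have {}E := E (codeB _ _ _ _ Bb Bb') (codeB _ _ _ _ Bc Bc').
    by case: (codeinj _ _ _ _ _ _ _ _ _ _ _ _ E) => // -> -> -> ->.
  - move=> _ _ [s [b [Bb ->]]] [s' [b' [Bb' ->]]].
    have [ss'|] := boolP (s || s').
      by exists (i (code s b s' b')); right; exists s, b, s', b'.
    case: s s' => [] [] //= _; have [c Gc] := Gdom _ _ Bb Bb'.
    by exists c; left.
  - move=> a b c [/Gran[? ? ?]|[s [d [s' [d' [Bd Bd' _ [-> -> ->]]]]]]].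
      by split; [exists false, a|exists false, b|exists false, c].
    split; [by exists s, d|by exists s', d'|].
    by exists true, (code s d s' d'); split=> //; exact: codeB.
  - by move=> _ [[] [b [Bb ->]]]; [have [] := iA _ Bb|exact: GA].
have /Gran[Bi _ _] :
    G (i (e 0%N), i (e 0%N), i (code true (e 0%N) true (e 0%N))).
  apply: (Gmax _ GNsq (@subsetUl _ _ _)); right.
  by exists true, (e 0%N), true, (e 0%N); split=> //; exact: Ge.
by have := iB _ (Ge 0%N).
Qed.

End infinite_square.

(** * Compactness, weighted suprema and metrisability *)

(** This replaces the choice of a finite subcover. If [P] failed on the whole space, the complements
    of the sets with [P] would form a proper filter, and a cluster point of it would have no
    neighbourhood with [P]. *)
Lemma compact_local_ind (T : topologicalType) (P : set T -> Prop) :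
  compact [set: T] -> P set0 ->
  (forall A B, A `<=` B -> P B -> P A) ->
  (forall A B, P A -> P B -> P (A `|` B)) ->
  (forall x : T, exists2 U, nbhs x U & P U) -> P [set: T].
Proof.
move=> cT P0 PS PU Ploc; apply: contrapT => nPT.
have PF : ProperFilter [set A | P (~` A)].
  apply: Build_ProperFilter; first by rewrite /= setC0.
  split=> /=; first by rewrite setCT.
    by move=> A B; rewrite /= setCI; exact: PU.
  by move=> A B AB; apply: PS; exact: subsetC.
have [|x [_ clx]] := cT _ PF; first by rewrite /= setCT.
have [U xU PUx] := Ploc x.
by have [|y []] := clx (~` U) U _ xU; first by rewrite /= setCK.
Qed.

Section weighted_supremum.
Context {R : realType} {K : topologicalType}.
Implicit Types (f : nat -> K -> R) (M e : R).

(** It merges a bounded nonnegative sequence into one function with the common zero set; the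
    decaying weights preserve continuity. *)
Definition wsup f (x : K) : R := sup (range (fun n => f n x / n.+1%:R)).

Lemma wsup_ge f M n x : (forall n x, 0 <= f n x <= M) ->
  f n x / n.+1%:R <= wsup f x.
Proof.
move=> fM; apply: ub_le_sup; last by exists n.
exists M => _ [m _ <-]; have /andP[f0 fm] := fM m x.
rewrite ler_pdivrMr ?ltr0n// (le_trans fm)// ler_peMr ?ler1n//.
exact: le_trans fm.
Qed.

Lemma wsup_le f x e : (forall n, f n x / n.+1%:R <= e) -> wsup f x <= e.
Proof.
by move=> fe; apply: ge_sup => [|_ [n _ <-]//]; exists (f 0%N x / 1%:R), 0%N.
Qed.

Lemma wsup_ge0 f M x : (forall n x, 0 <= f n x <= M) -> 0 <= wsup f x.
Proof.
move=> fM; apply: le_trans (wsup_ge 0 x fM).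
by rewrite divr_ge0//; have /andP[] := fM 0%N x.
Qed.

Lemma wsup_eq0 f M x : (forall n x, 0 <= f n x <= M) ->
  wsup f x = 0 <-> forall n, f n x = 0.
Proof.
move=> fM; split=> [f0 n|f0].
  have := wsup_ge n x fM; rewrite f0 ler_pdivrMr ?ltr0n// mul0r => fn0.
  by apply/eqP; rewrite eq_le fn0; have /andP[] := fM n x.
apply/eqP; rewrite eq_le (wsup_ge0 x fM) andbT.
by apply: wsup_le => n; rewrite f0 mul0r.
Qed.

(** Once [n.+1] exceeds [M / e], the weighted terms all lie between [0] and [e]; the finitely many
    others are controlled near [x] by continuity. *)
Lemma continuous_wsup f M : (forall n x, 0 <= f n x <= M) ->
  (forall n, continuous (f n)) -> continuous (wsup f).
Proof.
move=> fM cf x; apply/cvgrPdist_le => e e0.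
have near_lt N : \forall y \near x,
    forall n, (n < N)%N -> `|f n x - f n y| <= e.
  elim: N => [|N IHN]; first by apply: filterS filterT.
  have /cvgrPdist_le/(_ _ e0) := cf N x; apply: filterS2 IHN => y IH fNy n.
  by rewrite ltnS leq_eqVlt => /predU1P[->//|/IH].
apply: filterS (near_lt (Num.truncn (M / e)).+1) => y fy.
have {}fy n : `|f n x / n.+1%:R - f n y / n.+1%:R| <= e.
  rewrite -mulrBl normrM normfV [X in _ / X]ger0_norm// ler_pdivrMr ?ltr0n//.
  have [/fy fe|Nn] := ltnP n (Num.truncn (M / e)).+1.
    by rewrite (le_trans fe)// ler_peMr ?ler1n// ltW.
  have Me : M <= e * n.+1%:R.
    rewrite mulrC -ler_pdivrMr// (le_trans (ltW (truncnS_gt _)))//.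
    by rewrite ler_nat (leq_trans Nn).
  apply: le_trans Me; have /andP[? ?] := fM n x; have /andP[? ?] := fM n y.
  by rewrite ler_distl; apply/andP; split; lra.
rewrite ler_distl lerBlDr; apply/andP; split; apply: wsup_le => n.
  apply: (@le_trans _ _ (f n x / n.+1%:R + e)).
    by rewrite -lerBlDl; apply: le_trans (ler_norm _) _; rewrite distrC.
  by rewrite lerD2r (wsup_ge n x fM).
apply: (@le_trans _ _ (f n y / n.+1%:R + e)).
  by rewrite -lerBlDl; exact: le_trans (ler_norm _) (fy n).
by rewrite lerD2r (wsup_ge n y fM).
Qed.

End weighted_supremum.

(** The metric is the supremum of [|f n x - f n y| / n.+1]. It is continuous in [y], so its balls
    are neighbourhoods; compactness gives the converse. *)
Lemma metrisable_separating (R : realType) (K : topologicalType)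
    (f : nat -> K -> R) :
  compact [set: K] -> (forall n, continuous (f n)) ->
  (forall n x, `|f n x| <= 1) ->
  (forall x y, (forall n, f n x = f n y) -> x = y) ->
  metrisable R K.
Proof.
move=> cK cf f1 fsep.
pose df x n y : R := `|f n x - f n y|; pose d x := wsup (df x).
have dfb x n y : 0 <= df x n y <= 2.
  by rewrite normr_ge0/= (le_trans (ler_normB _ _))// lerD.
have cd x : continuous (d x).
  apply: continuous_wsup (dfb x) _ => n y.
  by apply: cvg_norm; apply: cvgB; [exact: cvg_cst|exact: cf].
have d0 x y : d x y = 0 <-> x = y.
  apply: (iff_trans (wsup_eq0 y (dfb x))); split=> [xy|-> n].
    by apply: fsep => n; apply/eqP; rewrite -subr_eq0 -normr_eq0 [`|_|]xy.
  by rewrite /df subrr normr0.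
exists d; split=> //.
- move=> x y; congr (sup _); apply: eq_imagel => n _.
  by rewrite /df distrC.
- move=> x y z; apply: wsup_le => n.
  apply: (@le_trans _ _ (df x n y / n.+1%:R + df y n z / n.+1%:R)).
    by rewrite -mulrDl ler_pM2r ?invr_gt0// ler_distD.
  by rewrite lerD//; [exact: wsup_ge (dfb x)|exact: wsup_ge (dfb y)].
- move=> x; apply/seteqP; split=> U /=; last first.
    move=> [e /= e0] eU; apply: filterS eU _.
    by have /cvgr_lt/(_ e) := cd x x; rewrite (d0 x x).2//; exact.
  move=> xU; suff [e e0 eU] : exists2 e, 0 < e &
      forall y, [set: K] y -> d x y < e -> U y.
    by exists e => // y; exact: eU.
  (* Near [x] the set [U] itself serves. Near any other [z], the points farther than [d x z / 2]
     from [x] satisfy the condition vacuously. *)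
  apply: (@compact_local_ind K (fun S => exists2 e, 0 < e &
      forall y, S y -> d x y < e -> U y)) => //.
  + by exists 1.
  + by move=> A B AB [e e0 eB]; exists e => // y /AB; exact: eB.
  + move=> A B [e e0 eA] [r r0 rB]; exists (Num.min e r).
      by rewrite lt_min e0.
    by move=> y [/eA|/rB] U_; rewrite lt_min => /andP[? ?]; exact: U_.
  + move=> z; have [<-|xz] := pselect (x = z).
      by exists U => //; exists 1.
    have dxz0 : 0 < d x z.
      rewrite lt_def (wsup_ge0 z (dfb x)) andbT; apply/eqP.
      by move=> /(d0 x z).1.
    exists [set y | d x z / 2 < d x y].
      have /cvgr_gt/(_ (d x z / 2)) := cd x z; apply.
      by rewrite ltr_pdivrMr// ltr_pMr// ltr1n.
    exists (d x z / 2); first by rewrite divr_gt0.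
    by move=> y /= /lt_trans /[apply]; rewrite ltxx.
Qed.

(** Urysohn functions [f n] for [F] and the complement of [V n] combine by [wsup] into a function
    with zero set exactly [F]; the maximum with a Urysohn function for [F] and [G] gives the value
    [1] on [G]. *)
Lemma Gdelta_separator (R : realType) (K : topologicalType) (F G : set K) :
  normal_space K -> closed F -> Gdelta F -> closed G -> F `&` G = set0 ->
  exists g : K -> R, [/\ continuous g, forall x, 0 <= g x <= 1,
    forall x, g x = 0 <-> F x & forall x, G x -> g x = 1].
Proof.
move=> nK clF [V oV FV] clG FG.
have sep A : closed A -> F `&` A = set0 -> exists f : K -> R,
    [/\ continuous f, forall x, 0 <= f x <= 1, forall x, F x -> f x = 0 &
        forall x, A x -> f x = 1].
  move=> cA FA; have := (@normal_separatorP R K).1 nK F A clF cA FA.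
  move=> /(@uniform_separatorP _ R)[f [cf f01 f0 f1]]; exists f; split=> //.
  - by move=> x; have := f01 _ (imageT f x); rewrite /= in_itv.
  - by move=> x Fx; apply: f0; exists x.
  - by move=> x Ax; apply: f1; exists x.
have [u [cu u01 u0 u1]] := sep _ clG FG.
have /choice[f fP] n : exists f : K -> R,
    [/\ continuous f, forall x, 0 <= f x <= 1, forall x, F x -> f x = 0 &
        forall x, ~ V n x -> f x = 1].
  apply: sep; first exact: open_closedC.
  by apply/disjoints_subset; rewrite setCK FV; exact: bigcap_inf.
have f01 n x : 0 <= f n x <= 1 by have [] := fP n.
exists (wsup f \max u); split.
- move=> x; apply: continuous_max; last exact: cu.
  by apply: continuous_wsup f01 _ _ => n; have [] := fP n.
- move=> x; rewrite le_max (wsup_ge0 x f01)/= ge_max; apply/andP; split.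
    apply: wsup_le => n; have /andP[f0 f1] := f01 n x.
    by rewrite ler_pdivrMr ?ltr0n// mul1r (le_trans f1)// ler1n.
  by have /andP[] := u01 x.
- move=> x; split=> [gx|Fx].
    have wx0 : wsup f x = 0.
      by apply/eqP; rewrite eq_le (wsup_ge0 x f01) andbT -gx le_max lexx.
    rewrite FV => n _; apply: contrapT; have [_ _ _ /[apply]] := fP n.
    by rewrite ((wsup_eq0 x f01).1 wx0) => /eqP; rewrite eq_sym oner_eq0.
  rewrite /Order.max_fun/= u0// ((wsup_eq0 x f01).2 _) ?maxxx// => n.
  by have [_ _ +_] := fP n; exact.
- move=> x Gx; rewrite /Order.max_fun/= u1//; apply: max_r.
  apply: wsup_le => n; have /andP[f0 f1] := f01 n x.
  by rewrite ler_pdivrMr ?ltr0n// mul1r (le_trans f1)// ler1n.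
Qed.

(** * Density and the lattice form of Stone-Weierstrass *)

Lemma card_le_dense (R : realType) (V : normedModType R) (A D : set V) :
  one_plus_separated A -> dense D -> (A #<= D)%card.
Proof.
move=> sepA dD; have /choice[d dP] (a : V) : exists d, D d /\ `|a - d| < 1 / 2.
  have [||d [ad Dd]] := dD (ball a (1 / 2)).
  - by exists a; exact: ballxx.
  - exact: ball_open.
  - by exists d; rewrite -ball_normE in ad.
apply/pcard_leP/injfunPex; exists d => [a _|a b /set_mem Aa /set_mem Ab dab].
  by have [] := dP a.
apply: contrapT => /(sepA _ _ Aa Ab); apply/negP; rewrite -leNgt.
have [_ ad] := dP a; have [_ bd] := dP b; rewrite -dab distrC in bd.
by rewrite (le_trans (ler_distD (d a) _ _))// [leRHS]splitr lerD// ltW.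
Qed.

(** Lattice polynomials are kept as syntax so that they can be counted by coding. *)
Inductive lattice_term (T : Type) : Type :=
| Affine of rat & rat & T
| Join of lattice_term T & lattice_term T
| Meet of lattice_term T & lattice_term T.

(** Terms are coded in [A] by an injection [p] of its square. Every constructor becomes a nested
    triple headed by a tag [e 0], [e 1] or [e 2], so one injectivity argument serves all three. *)
Lemma card_lattice_term (T : pointedType) (A : set T) :
  infinite_set A -> ([set: lattice_term A] #<= A)%card.
Proof.
move=> Ainf; have /pcard_leP/injfunPex[p pA pinj] := infinite_card_setX Ainf.
have {}pA a b : A a -> A b -> A (p (a, b)) by move=> Aa Ab; apply: (pA (a, b)).
have {}pinj a b a' b' : A a -> A b -> A a' -> A b' ->
    p (a, b) = p (a', b') -> a = a' /\ b = b'.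
  move=> Aa Ab Aa' Ab' E.
  by have [] : (a, b) = (a', b') by apply: pinj => //; exact/mem_set.
have /infiniteP/pcard_leP/injfunPex[e eA /in2TT einj] := Ainf.
have {}eA n : A (e n) by exact: eA.
have {}einj m n : e m = e n -> m = n by apply: einj; rewrite inE.
pose fix code (t : lattice_term A) : T := match t with
  | Affine q r a => p (e 0%N, p (e (pickle (q, r)), val a))
  | Join s t => p (e 1%N, p (code s, code t))
  | Meet s t => p (e 2%N, p (code s, code t))
  end.
have valA (a : A) : A (sval a) by exact/set_mem/valP.
have codeA t : A (code t).
  by elim: t => [q r a|s As t At|s As t At] /=;
    apply: (pA) => //; apply: (pA) => //.
apply/pcard_leP/injfunPex; exists code => [t _|s t _ _]; first exact: codeA.
have inj2 a b c a' b' c' : A a -> A b -> A c -> A a' -> A b' -> A c' ->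
    p (a, p (b, c)) = p (a', p (b', c')) -> [/\ a = a', b = b' & c = c'].
  by move=> Aa Ab Ac Aa' Ab' Ac' /pinj[]; auto => -> /pinj[]// -> ->.
elim: s t => [q r a|s1 IH1 s2 IH2|s1 IH1 s2 IH2];
  case=> [q' r' a'|t1 t2|t1 t2] /= /inj2[]; auto; try by move=> /einj.
- by move=> _ /einj/(pcan_inj pickleK)[-> ->] /val_inj->.
- by move=> _ /IH1-> /IH2->.
- by move=> _ /IH1-> /IH2->.
Qed.

Section lattice_density.
Context {R : realType} {K : topologicalType} {cK : compact [set: K]}.
Local Notation CK := (C R cK).

Lemma C_continuous (f : CK) : continuous (f : K -> R).
Proof. by have := C_funP f; rewrite inE. Qed.

Lemma C_subE (f g : CK) x : (f - g) x = f x - g x.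
Proof. by []. Qed.

Lemma cfun_cst (r : R) : (fun=> r) \in @cfun R K.
Proof. by rewrite inE => x; exact: cvg_cst. Qed.

Lemma cfun_max (f g : CK) : (f : K -> R) \max g \in cfun.
Proof.
by rewrite inE => x; apply: continuous_max; exact: C_continuous.
Qed.

Lemma cfun_min (f g : CK) : (f : K -> R) \min g \in cfun.
Proof.
by rewrite inE => x; apply: continuous_min; exact: C_continuous.
Qed.

Fixpoint lattice_eval (A : set CK) (t : lattice_term A) : CK :=
  match t with
  | Affine p q a => ratr p *: val a + MkC cK (cfun_cst (ratr q))
  | Join s t => MkC cK (cfun_max (lattice_eval s) (lattice_eval t))
  | Meet s t => MkC cK (cfun_min (lattice_eval s) (lattice_eval t))
  end.

Definition separating (A : set CK) : Prop :=
  forall x y, (forall f, A f -> f x = f y) -> x = y.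

Lemma rat_approx (r e : R) : 0 < e -> exists q : rat, `|ratr q - r| < e.
Proof.
move=> e0; have [q] := @rat_in_itvoo R (r - e) (r + e) ltac:(lra).
by rewrite in_itv/= -ltr_distl => qr; exists q.
Qed.

(** Real coefficients [u] and [v] interpolate exactly, with slope [0] when [x = y]; rational ones
    close to them cost less than [e]. *)
Lemma affine_interpolation (A : set CK) (f : CK) x y (e : R) :
  A !=set0 -> separating A -> 0 < e -> exists t : lattice_term A,
    `|lattice_eval t x - f x| < e /\ `|lattice_eval t y - f y| < e.
Proof.
move=> A0 sepA e0.
have [a [u [v [fx fy]]]] : exists a : A, exists u v : R,
    u * (val a : CK) x + v = f x /\ u * (val a : CK) y + v = f y.
  have [<-|xy] := pselect (x = y).
    have [a Aa] := A0; exists (SigSub (mem_set Aa)), 0, (f x).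
    by rewrite mul0r add0r.
  have [a [Aa axy]] : exists a, A a /\ a x <> a y.
    apply: contrapT => /forallNP na; apply/xy/sepA => a Aa.
    by apply: contrapT => axy; exact: (na a).
  have {}axy : a x - a y != 0 by rewrite subr_eq0; apply/eqP.
  exists (SigSub (mem_set Aa)), ((f x - f y) / (a x - a y)).
  exists (f x - (f x - f y) / (a x - a y) * a x).
  by split; rewrite /=; field.
(* The added [1] keeps the divisor positive even if [val a] is zero. *)
have Na : 0 < supnorm (val a) + 1 by rewrite ltr_wpDl ?supnorm_ge0.
have e20 : 0 < e / 2 by rewrite divr_gt0.
have [p pu] := rat_approx u (divr_gt0 e20 Na).
have [q qv] := rat_approx v e20.
exists (Affine p q a).
suff approx z : `|lattice_eval (Affine p q a) z - (u * (val a : CK) z + v)| < e.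
  by rewrite -fx -fy.
have -> : lattice_eval (Affine p q a) z - (u * (val a : CK) z + v) =
    (ratr p - u) * (val a : CK) z + (ratr q - v).
  rewrite (_ : lattice_eval _ z = ratr p * (val a : CK) z + ratr q)//.
  by ring.
rewrite (le_lt_trans (ler_normD _ _))// [ltRHS]splitr ler_ltD//.
rewrite normrM.
apply: (@le_trans _ _ (e / 2 / (supnorm (val a) + 1) * (supnorm (val a) + 1))).
  by rewrite ler_pM// ?ltW// (le_lt_trans (supnorm_ge _ z))// ltrDl.
by rewrite divfK// gt_eqF.
Qed.

(** Interpolants at [x] and [y] exceed [f - e] near [y]; joining finitely many of them gives this
    bound everywhere and keeps the upper bound at [x]. *)
Lemma lattice_approx_below (A : set CK) (f : CK) x (e : R) :
  A !=set0 -> separating A -> 0 < e -> exists t : lattice_term A,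
    lattice_eval t x < f x + e /\ forall z, f z - e < lattice_eval t z.
Proof.
move=> A0 sepA e0; suff [t [tx tf]] : exists t : lattice_term A,
    lattice_eval t x < f x + e /\
    forall z, [set: K] z -> f z - e < lattice_eval t z.
  by exists t; split=> // z; exact: tf.
apply: (@compact_local_ind K (fun S => exists t : lattice_term A,
  lattice_eval t x < f x + e /\ forall z, S z -> f z - e < lattice_eval t z)).
- exact: cK.
- have [t [+ _]] := affine_interpolation f x x A0 sepA e0.
  by rewrite ltr_distl => /andP[_ tx]; exists t.
- by move=> S S' SS' [t [tx tf]]; exists t; split=> // z /SS'; exact: tf.
- move=> S S' [s [sx sf]] [t [tx tf]]; exists (Join s t); split.
    by rewrite /= /Order.max_fun gt_max sx tx.
  by move=> z [/sf|/tf] fz; rewrite /= /Order.max_fun lt_max fz ?orbT.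
- move=> y; have [t []] := affine_interpolation f x y A0 sepA e0.
  rewrite !ltr_distl => /andP[_ tx] /andP[ty _].
  exists [set z | - e < (lattice_eval t - f) z].
    have /cvgr_gt/(_ (- e)) := @C_continuous (lattice_eval t - f) y; apply.
    by rewrite C_subE; lra.
  by exists t; split=> // z; rewrite /mkset C_subE => ?; lra.
Qed.

(** Dually, terms above [f - e] everywhere and below [f + e] near one point are combined by finitely
    many meets. *)
Lemma lattice_approx (A : set CK) (f : CK) (e : R) :
  A !=set0 -> separating A -> 0 < e -> exists t : lattice_term A,
    forall z, `|lattice_eval t z - f z| < e.
Proof.
move=> A0 sepA e0; suff [t [tlo thi]] : exists t : lattice_term A,
    (forall z, f z - e < lattice_eval t z) /\
    forall z, [set: K] z -> lattice_eval t z < f z + e.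
  by exists t => z; rewrite ltr_distl tlo thi.
apply: (@compact_local_ind K (fun S => exists t : lattice_term A,
  (forall z, f z - e < lattice_eval t z) /\
  forall z, S z -> lattice_eval t z < f z + e)).
- exact: cK.
- have [a Aa] := A0; have [q] := rat_approx (supnorm f) e0.
  rewrite ltr_distl => /andP[qf _].
  (* For the empty set a constant above [supnorm f - e] suffices. *)
  exists (Affine 0 q (SigSub (mem_set Aa))); split=> // z.
  rewrite (_ : lattice_eval _ z = ratr q); last first.
    by rewrite /= raddf0 scale0r add0r.
  by have := supnorm_ge f z; rewrite ler_norml => /andP[_ fz]; lra.
- by move=> S S' SS' [t [tlo thi]]; exists t; split=> // z /SS'; exact: thi.
- move=> S S' [s [slo shi]] [t [tlo thi]]; exists (Meet s t); split.
    by move=> z; rewrite /= /Order.min_fun lt_min slo tlo.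
  by move=> z [/shi|/thi] fz; rewrite /= /Order.min_fun gt_min fz ?orbT.
- move=> y; have [t [ty tlo]] := lattice_approx_below f y A0 sepA e0.
  exists [set z | (lattice_eval t - f) z < e].
    have /cvgr_lt/(_ e) := @C_continuous (lattice_eval t - f) y; apply.
    by rewrite C_subE; lra.
  by exists t; split=> // z; rewrite /mkset C_subE => ?; lra.
Qed.

Lemma dense_lattice (A : set CK) : A !=set0 -> separating A ->
  dense (range (@lattice_eval A)).
Proof.
move=> A0 sepA O [f Of] oO.
have /nbhs_ballP[e /= e0 eO] := open_nbhs_nbhs (conj oO Of).
have e20 : 0 < e / 2 by rewrite divr_gt0.
have [t tf] := lattice_approx f A0 sepA e20.
exists (lattice_eval t); split; last exact: imageT.
apply: eO; rewrite -ball_normE/= distrC.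
apply: (@le_lt_trans _ _ (e / 2)).
  2: by rewrite ltr_pdivrMr// ltr_pMr// ltr1n.
by apply: supnorm_le => [|z]; [exact: ltW|exact/ltW/tf].
Qed.

Lemma separating_has_density_card (A : set CK) :
  infinite_set A -> one_plus_separated A -> separating A ->
  has_density_card CK A.
Proof.
move=> Ainf A1 sepA; split; last by move=> D; exact: card_le_dense.
have dD := dense_lattice (infinite_setN0 Ainf) sepA.
exists (range (@lattice_eval A)) => //; rewrite card_eq_le card_le_dense//=.
exact: card_le_trans (card_image_le _ _) (card_lattice_term Ainf).
Qed.

End lattice_density.

(** * Maximal separated and equilateral families *)

(** Zorn's lemma for pairwise related subsets of [S]. In the last clause [x] may already lie in [A],
    hence the guard [x <> y]. *)
Lemma maximal_pairwise (T : Type) (S : set T) (r : T -> T -> Prop) :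
  (forall x y, r x y -> r y x) ->
  exists A, [/\ A `<=` S, forall x y, A x -> A y -> x <> y -> r x y &
    forall x, S x -> (forall y, A y -> x <> y -> r x y) -> A x].
Proof.
move=> rsym; pose P (A : set T) :=
  A `<=` S /\ forall x y, A x -> A y -> x <> y -> r x y.
have [A [[AS Ar] Amax]] : exists A, P A /\ forall B, A `<` B -> ~ P B.
  apply: Zorn_bigcup => F FP Ftot; split; first by apply: bigcup_sub => X /FP[].
  move=> x y [X FX Xx] [Y FY Yy]; have [XY|YX] := Ftot _ _ FX FY.
    by have [_] := FP _ FY; apply => //; exact: XY.
  by have [_] := FP _ FX; apply => //; exact: YX.
exists A; split=> // x Sx rx; apply: contrapT => nAx.
apply: (Amax (A `|` [set x])).
  split; first exact: subsetUl.
  by move=> /(_ x); apply/not_implyP; split=> //; right.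
split; first by move=> y [/AS//|->].
move=> y z [Ay|->] [Az|->] //; first exact: Ar.
- by move=> yx; apply/rsym/rx => // /esym.
- exact: rx.
Qed.

(** The default [d] is there for the empty set, which no sequence enumerates. *)
Lemma countable_enum (T : Type) (A : set T) (d : T) : countable A ->
  exists s : nat -> T, (forall n, A (s n) \/ s n = d) /\ A `<=` range s.
Proof.
move=> /pfcard_geP[->|[s]]; first by exists (fun=> d); split=> // n; right.
exists s; split=> [n|a Aa]; first by left; exact: funS.
by have [n _ <-] := @surj _ _ _ _ s a Aa; exists n.
Qed.

Section continuous_functions.
Context {R : realType} {K : topologicalType} {cK : compact [set: K]}.
Hypothesis hK : hausdorff_space K.
Local Notation CK := (C R cK).

Lemma unit_sphere_C (f : CK) x : (forall z, `|f z| <= 1) -> `|f x| = 1 ->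
  unit_sphere CK f.
Proof.
move=> f1 fx; apply/eqP; rewrite eq_le; apply/andP; split.
  exact: supnorm_le.
by rewrite -fx; exact: supnorm_ge.
Qed.

Lemma unit_sphere_le1 (f : CK) x : unit_sphere CK f -> `|f x| <= 1.
Proof. by move=> <-; exact: supnorm_ge. Qed.

Lemma lt_norm_at (f g : CK) x (e : R) : e < `|f x - g x| -> e < `|f - g|.
Proof. by move=> /lt_le_trans; apply; exact: supnorm_ge (f - g) x. Qed.

(** An enumeration of [A] would metrise [K]; the default [0] respects the bound by [1]. *)
Lemma separating_uncountable (A : set CK) : ~ metrisable R K ->
  A `<=` unit_sphere CK -> separating A -> ~ countable A.
Proof.
move=> nmK AS sepA /(@countable_enum _ _ 0)[s [As sA]]; apply: nmK.
apply: (@metrisable_separating _ _ (fun n => s n : K -> R)) => //.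
- by move=> n; exact: C_continuous.
- move=> n x; have [/AS/unit_sphere_le1//|->] := As n.
  by rewrite normr0 ler01.
- by move=> x y sxy; apply: sepA => f /sA[n _ <-].
Qed.

(* A function equal to [1] near a zero of [f] is then at distance greater than
   [1] from [f]. *)
Definition zeros_near_negative (f : CK) : Prop :=
  forall x, f x = 0 -> closure [set z | f z < 0] x.

(** [f] is [g - h], where [g] vanishes exactly on the closure of [V] and [h] exactly off [V]. Thus
    [f] is negative exactly on [V], and its zeros lie in the closure of [V]. *)
Lemma zeros_near_negative_separator x y : perfectly_normal K -> x <> y ->
  exists f : CK, [/\ unit_sphere CK f, zeros_near_negative f,
    \forall z \near x, f z = 1 & f y = -1].
Proof.
move=> pnK xy; have nK : normal_space K := compact_normal hK cK.
have cl1 (z : K) : closed [set z].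
  exact: accessible_closed_set1 (hausdorff_accessible hK) z.
have [||||q [cq q01 q0 q1]] := @Gdelta_separator R K [set y] [set x] nK.
- exact: cl1.
- exact/pnK/cl1.
- exact: cl1.
- by rewrite -subset0 => z [-> /esym].
(* The gap between the two levels keeps the closure of [V] disjoint from [W]. *)
pose V := [set z | q z < 1 / 3]; pose W := [set z | 2 / 3 <= q z].
have oV : open V by apply: open_comp (@open_lt R _); move=> z _; exact: cq.
have clV : closure V `<=` [set z | q z <= 1 / 3].
  rewrite [X in _ `<=` X](@closure_id _ _).1; last first.
    by apply: closed_comp (@closed_le R _); move=> z _; exact: cq.
  by apply: closureS => z /ltW.
have cW : closed W by apply: closed_comp (@closed_ge R _); move=> z _; exact: cq.
have Vy : V y by rewrite /V/= (q0 y).2//; lra.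
have Wx : \forall z \near x, W z.
  have /cvgr_ge/(_ (2 / 3)) := cq x; apply.
  by rewrite q1//; lra.
have cEV := @closed_closure _ V.
have [|g [cg g01 g0 g1]] :=
    @Gdelta_separator R K (closure V) W nK cEV (pnK _ cEV) cW.
  by rewrite -subset0 => z [/clV/= + Wz]; move: Wz; rewrite /W/=; lra.
have cnV : closed (~` V) := open_closedC oV.
have [|h [ch h01 h0 h1]] :=
    @Gdelta_separator R K (~` V) [set y] nK cnV (pnK _ cnV) (cl1 y).
  by rewrite -subset0 => z [/= + zy]; rewrite zy.
have cf : (fun z => g z - h z) \in @cfun R K.
  by rewrite inE => z; apply: cvgB; [exact: cg|exact: ch].
have fy : g y - h y = -1.
  by rewrite h1// (g0 y).2 ?sub0r//; exact: subset_closure.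
have hE z : ~ V z -> h z = 0 by move=> nVz; apply/(h0 z).2.
have gE z : closure V z -> g z = 0 by move=> Vz; apply/(g0 z).2.
exists (MkC cK cf); split=> /=.
- apply: (@unit_sphere_C _ y) => [z|]; last by rewrite /= fy normrN1.
  have /andP[? ?] := g01 z; have /andP[? ?] := h01 z.
  by rewrite ler_norml /=; apply/andP; split; lra.
- move=> z /= fz; have Vz : closure V z.
    have [Vz|/hE hz] := pselect (V z); first exact: subset_closure.
    by apply/(g0 z).1; rewrite -fz hz subr0.
  apply: closureS Vz => w Vw; rewrite /= gE ?sub0r; last exact: subset_closure.
  rewrite oppr_lt0 lt_def; have /andP[-> _] := h01 w; rewrite andbT.
  by apply/eqP => /(h0 w).1.
- apply: filterS Wx => z Wz; rewrite g1// hE ?subr0//.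
  move=> /(le_lt_trans Wz).
  by rewrite ltr_pM2r ?invr_gt0// ltNge ler1n.
- exact: fy.
Qed.

Lemma one_plus_separated_step (f g : CK) x y :
  zeros_near_negative g -> g x = g y -> (\forall z \near x, f z = 1) ->
  f y = -1 -> 1 < `|f - g|.
Proof.
move=> g0 gxy fx1 fy; have fx : f x = 1 by exact: nbhs_singleton fx1.
have [gx|gx|gx] := ltgtP (g x) 0.
- by apply: (@lt_norm_at _ _ x); rewrite fx ltr_normr; apply/orP; left; lra.
- by apply: (@lt_norm_at _ _ y); rewrite fy -gxy ltr_normr; apply/orP; right; lra.
- have [z [gz fz]] := g0 _ gx _ fx1.
  apply: (@lt_norm_at _ _ z); rewrite fz ltr_normr; apply/orP; left.
  by move: gz => /=; lra.
Qed.

Lemma perfectly_normal_separated : perfectly_normal K ->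
  exists A : set CK,
    [/\ A `<=` unit_sphere CK, one_plus_separated A & separating A].
Proof.
move=> pnK; have [|A [AS A1 Amax]] := @maximal_pairwise CK
  (unit_sphere CK `&` zeros_near_negative) (fun f g => 1 < `|f - g|).
  by move=> f g; rewrite distrC.
exists A; split=> // [f /AS[]//|x y Axy]; apply: contrapT => xy.
have [f [f1 f0 fx fy]] := zeros_near_negative_separator pnK xy.
have /Axy : A f.
  apply: Amax => // g Ag _; have [_ g0] := AS _ Ag.
  exact: one_plus_separated_step g0 (Axy _ Ag) fx fy.
by rewrite (nbhs_singleton fx) fy; lra.
Qed.

(** Otherwise [F] would be the zero set of the continuous function [wsup w], hence the intersection
    of its open sublevel sets. *)
Lemma not_Gdelta_point (F : set K) (s : nat -> CK) :
  ~ Gdelta F -> (forall n x, `|s n x| <= 1) ->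
  (forall n x, F x -> s n x = 1) -> exists x, ~ F x /\ forall n, s n x = 1.
Proof.
move=> nGF s1 sF; apply: contrapT => nx; apply: nGF.
pose w n (x : K) : R := 1 - s n x.
have w02 n x : 0 <= w n x <= 2.
  have := s1 n x; rewrite ler_norml /w => /andP[? ?].
  by apply/andP; split; lra.
have cw : continuous (wsup w).
  apply: continuous_wsup w02 _ => n x.
  by apply: cvgB; [exact: cvg_cst|exact: C_continuous].
exists (fun n => [set x | wsup w x < n.+1%:R^-1]).
  by move=> n; apply: open_comp (@open_lt R _); move=> x _; exact: cw.
apply/seteqP; split=> [x Fx n _|x wx].
  by rewrite /= ((wsup_eq0 x w02).2 _) ?invr_gt0// => m; rewrite /w sF ?subrr.
apply: contrapT => nFx; apply: nx; exists x; split=> // n.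
suff wx0 : wsup w x = 0.
  have wn0 : 1 - s n x = 0 := (wsup_eq0 x w02).1 wx0 n.
  by apply/eqP; rewrite eq_sym -subr_eq0 wn0.
apply/eqP; rewrite eq_le (wsup_ge0 x w02) andbT leNgt; apply/negP => wx0.
(* This index [n] makes [n.+1%:R^-1] smaller than [wsup w x]. *)
have := wx (Num.truncn (wsup w x)^-1) I.
rewrite /= -[ltLHS]invrK ltf_pV2 ?posrE ?invr_gt0//; apply/negP.
by rewrite -leNgt ltW// truncnS_gt.
Qed.

Lemma not_perfectly_normal_equilateral : ~ perfectly_normal K ->
  exists A : set CK,
    [/\ A `<=` unit_sphere CK, equilateral 2 A & ~ countable A].
Proof.
move=> /existsNP[F /not_implyP[cF nGF]].
(* The value [-1] ensures norm one. *)
pose S (f : CK) := [/\ forall x, `|f x| <= 1, forall x, F x -> f x = 1 &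
  exists x, f x = -1].
have [|A [AS A2 Amax]] := @maximal_pairwise CK S (fun f g => `|f - g| = 2).
  by move=> f g; rewrite distrC.
exists A; split=> //.
  move=> f /AS[f1 _ [x fx]].
  by apply: (@unit_sphere_C f x); rewrite ?fx ?normrN1.
(* The default [1] is bounded by [1] and equals [1] on [F], as [not_Gdelta_point] requires. *)
move=> /(@countable_enum _ _ (MkC cK (cfun_cst 1)))[s [As sA]].
have s1 n x : `|s n x| <= 1.
  by have [/AS[]//|->] := As n; rewrite normr1.
have sF n x : F x -> s n x = 1.
  by have [/AS[_ + _]|->//] := As n; exact.
have [x [nFx sx]] := not_Gdelta_point nGF s1 sF.
have cx : closed [set x].
  exact: accessible_closed_set1 (hausdorff_accessible hK) x.
have Fx0 : F `&` [set x] = set0.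
  by rewrite -subset0 => z [Fz zx]; apply: nFx; rewrite -zx.
have := (@normal_separatorP R K).1 (compact_normal hK cK) F _ cF cx Fx0.
move=> /(@uniform_separatorP _ R)[u [cu u01 u0 u1]].
have cf : (fun z => 1 - (u z + u z)) \in @cfun R K.
  rewrite inE => z; apply: cvgB; first exact: cvg_cst.
  by apply: cvgD; exact: cu.
pose f := MkC cK cf.
have fx : f x = -1 by rewrite /= (u1 (u x)); [lra|exists x].
have f1 z : `|f z| <= 1.
  have := u01 _ (imageT u z); rewrite /= in_itv/= => /andP[? ?].
  by rewrite ler_norml /=; apply/andP; split; lra.
have Sf : S f.
  split=> //; last by exists x.
  by move=> z Fz; rewrite /= (u0 (u z)); [lra|exists z].
(* At [x] every member of [A] is [1] and [f] is [-1], so all distances to [f] are [2]. Maximality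
   puts [f] into [A], which then has a member equal to [-1] at [x]. *)
have /sA[n _ snf] : A f.
  apply: Amax => // g Ag _; have [n _ sg] := sA _ Ag; rewrite -sg in Ag *.
  apply/eqP; rewrite eq_le; apply/andP; split.
    apply: supnorm_le => // z; rewrite C_subE.
    by rewrite (le_trans (ler_normB _ _))// lerD.
  apply: le_trans (supnorm_ge (f - s n) x); rewrite C_subE fx sx.
  by rewrite ler_normr; apply/orP; right; lra.
by have := sx n; rewrite snf fx; lra.
Qed.

End continuous_functions.

Unset Implicit Arguments.

Theorem theoremB (R : realType) (K : topologicalType)
    (cK : compact [set: K]) (hK : hausdorff_space K)
    (nmK : ~ metrisable R K) :
  [/\ exists A : set (C R cK),
        [/\ A `<=` unit_sphere (C R cK), one_plus_separated A & ~ countable A],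
      ~ perfectly_normal K ->
        exists A : set (C R cK),
          [/\ A `<=` unit_sphere (C R cK), equilateral 2 A & ~ countable A] &
      perfectly_normal K ->
        exists A : set (C R cK),
          [/\ A `<=` unit_sphere (C R cK), one_plus_separated A &
              has_density_card (C R cK) A]].
Proof.
split.
- have [pnK|npnK] := pselect (perfectly_normal K).
    have [A [AS A1 sepA]] := @perfectly_normal_separated R K cK hK pnK.
    by exists A; split=> //; exact: separating_uncountable.
  have [A [AS A2 Aunc]] := @not_perfectly_normal_equilateral R K cK hK npnK.
  by exists A; split=> // f g Af Ag fg; rewrite A2// ltr1n.
- exact: not_perfectly_normal_equilateral.
- move=> pnK; have [A [AS A1 sepA]] := @perfectly_normal_separated R K cK hK pnK.
  exists A; split=> //; apply: separating_has_density_card => //.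
  by move=> /finite_set_countable; exact: separating_uncountable.
Qed.
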